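(* The following are equivalent over ${\sf RCA}_0$: (1) Every countable graph has a connected component. (2) For each weak partition $\langle D_i : i\in\mathbb{N}\rangle$ of $\mathbb{N}$, there is an $i$ such that $D_i$ exists.
   Context: ${\sf RCA}_0$: basic axioms, $\Delta^0_1$ comprehension, $\Sigma^0_1$ induction. A countable graph is a pair $(V,E)$ with $V$ a nonempty infinite subset of $\mathbb{N}$ and $E$ a set of unordered pairs from $V$; a connected component is a set $C\subseteq V$ any two elements of which are joined by a finite path and such that if $x\in C$ and there is a path from $x$ to $y$ then $y\in C$. An enumerated sequence of enumerated sets is a function $D\colon\mathbb{N}\to\mathbb{N}\times\mathbb{N}$, written $\langle D_i : i\in\mathbb{N}\rangle$, where $j\in D_i$ means there is an $s$ with $D(s)=\langle i,j\rangle$; $D_i=D_j$ means $(\forall n)[n\in D_i\Leftrightarrow n\in D_j]$, and $D_i\cap D_j=\emptyset$ is expressed similarly. $D_i$ exists if there is a set containing exactly those $j$ for which some $k$ has $D(k)=\langle i,j\rangle$. A weak partition of $\mathbb{N}$ is such a $D$ with: (i) for every $n$ there is an $i$ with $n\in D_i$; (ii) for all $i,j$, either $D_i=D_j$ or $D_i\cap D_j=\emptyset$. *)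

(* Defs.v *)
(** Second-order arithmetic (language L2), its general (Henkin) models, RCA_0,
    and the two principles about graphs and weak partitions, all relativized
    to a model.  Only the Rocq standard prelude is used.

    "Equivalent over RCA_0" is read as: equivalent in every model of RCA_0.
    Models may be non-standard, so every number quantifier below ranges over
    the first-order part [num M], and every set quantifier is restricted to the
    second-order part [is_set M].  No definition of a principle refers to the
    standard [nat]; [nat] only serves to index variables of L2 formulas. *)

(** * Structures for the language of second-order arithmetic *)

Record L2_structure : Type := {
  num : Type;
  zero : num;
  one : num;
  add : num -> num -> num;
  mul : num -> num -> num;
  lt : num -> num -> Prop;
  is_set : (num -> Prop) -> Prop;
  is_set_inhabited : exists X, is_set X
}.

Arguments zero {_}.
Arguments one {_}.
Arguments add {_} _ _.
Arguments mul {_} _ _.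
Arguments lt {_} _ _.

Declare Scope L2_scope.
Delimit Scope L2_scope with L2.
Notation "0" := zero : L2_scope.
Notation "1" := one : L2_scope.
Notation "x + y" := (add x y) : L2_scope.
Notation "x * y" := (mul x y) : L2_scope.
Notation "x < y" := (lt x y) : L2_scope.
Open Scope L2_scope.

(** * Bounded-quantifier formulas with number and set parameters *)

(** Number variables are de Bruijn indices.  In [BAll t A] and [BEx t A] the
    bound [t] lies outside the scope of the new variable, which is the usual
    proviso that the bound does not contain the quantified variable.  Set
    variables are never quantified in these formulas: they are parameters. *)

Inductive term : Type :=
| TVar (k : nat)
| TZero
| TOne
| TAdd (t u : term)
| TMul (t u : term).

Inductive bformula : Type :=
| BEq (t u : term)
| BLt (t u : term)
| BMem (t : term) (k : nat)
| BNot (A : bformula)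
| BAnd (A B : bformula)
| BOr (A B : bformula)
| BImp (A B : bformula)
| BAll (t : term) (A : bformula)
| BEx (t : term) (A : bformula).

Definition scons {T : Type} (x : T) (e : nat -> T) (k : nat) : T :=
  match k with
  | O => x
  | S k' => e k'
  end.

Fixpoint teval (M : L2_structure) (e : nat -> num M) (t : term) : num M :=
  match t with
  | TVar k => e k
  | TZero => 0
  | TOne => 1
  | TAdd t u => teval M e t + teval M e u
  | TMul t u => teval M e t * teval M e u
  end.

Fixpoint bsat (M : L2_structure) (s : nat -> num M -> Prop)
    (e : nat -> num M) (A : bformula) : Prop :=
  match A with
  | BEq t u => teval M e t = teval M e u
  | BLt t u => teval M e t < teval M e u
  | BMem t k => s k (teval M e t)
  | BNot A => ~ bsat M s e A
  | BAnd A B => bsat M s e A /\ bsat M s e B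
  | BOr A B => bsat M s e A \/ bsat M s e B
  | BImp A B => bsat M s e A -> bsat M s e B
  | BAll t A => forall x, x < teval M e t -> bsat M s (scons x e) A
  | BEx t A => exists x, x < teval M e t /\ bsat M s (scons x e) A
  end.

(** A Sigma^0_1 (resp. Pi^0_1) formula is one existential (resp. universal)
    number quantifier in front of a bounded-quantifier formula [A]; it is
    represented by its matrix [A], in which the quantified variable is 0. *)

Definition Sigma01_sat (M : L2_structure) (s : nat -> num M -> Prop)
    (e : nat -> num M) (A : bformula) : Prop :=
  exists x, bsat M s (scons x e) A.

Definition Pi01_sat (M : L2_structure) (s : nat -> num M -> Prop)
    (e : nat -> num M) (A : bformula) : Prop :=
  forall x, bsat M s (scons x e) A.

(** * RCA_0 *)

Record basic_axioms (M : L2_structure) : Prop := {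
  succ_neq_zero : forall n : num M, n + 1 <> 0;
  succ_inj : forall m n : num M, m + 1 = n + 1 -> m = n;
  add_zero : forall m : num M, m + 0 = m;
  add_succ : forall m n : num M, m + (n + 1) = (m + n) + 1;
  mul_zero : forall m : num M, m * 0 = 0;
  mul_succ : forall m n : num M, m * (n + 1) = m * n + m;
  not_lt_zero : forall m : num M, ~ m < 0;
  lt_succ : forall m n : num M, m < n + 1 <-> m < n \/ m = n
}.

Definition Sigma01_induction (M : L2_structure) : Prop :=
  forall (A : bformula) (s : nat -> num M -> Prop) (e : nat -> num M),
    (forall k, is_set M (s k)) ->
    Sigma01_sat M s (scons 0 e) A ->
    (forall n, Sigma01_sat M s (scons n e) A ->
               Sigma01_sat M s (scons (n + 1) e) A) ->
    forall n, Sigma01_sat M s (scons n e) A.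

Definition Delta01_comprehension (M : L2_structure) : Prop :=
  forall (A B : bformula) (s : nat -> num M -> Prop) (e : nat -> num M),
    (forall k, is_set M (s k)) ->
    (forall n, Sigma01_sat M s (scons n e) A <-> Pi01_sat M s (scons n e) B) ->
    exists X, is_set M X /\ forall n, X n <-> Sigma01_sat M s (scons n e) A.

Record RCA0 (M : L2_structure) : Prop := {
  RCA0_basic : basic_axioms M;
  RCA0_induction : Sigma01_induction M;
  RCA0_comprehension : Delta01_comprehension M
}.

(** * Coding of pairs and finite sequences *)

(** The usual pairing of second-order arithmetic, (x + y)^2 + x. *)
Definition pair {M : L2_structure} (x y : num M) : num M :=
  (x + y) * (x + y) + x.

(** [c] = <k,<m,n>> codes the finite set of those i < k such that
    m(i+1)+1 divides n.  The code of a finite set is not required to be the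
    least one, so a finite set has several codes. *)
Definition code_mem {M : L2_structure} (i c : num M) : Prop :=
  exists k m n : num M,
    c = pair k (pair m n) /\ i < k /\ exists q, n = q * (m * (i + 1) + 1).

(** [c] codes a sequence of length [l], i.e. the finite set of pairs <i,u>
    that is the graph of a function with domain {i : i < l}. *)
Definition finite_sequence {M : L2_structure} (c l : num M) : Prop :=
  (forall a, code_mem a c -> exists i u, a = pair i u) /\
  (forall i u v, code_mem (pair i u) c -> code_mem (pair i v) c -> u = v) /\
  (forall i, i < l <-> exists u, code_mem (pair i u) c).

(** * Graphs *)

(** An unordered pair {x,y}, x <> y, is coded by <x,y> with x < y. *)
Record countable_graph (M : L2_structure) (V E : num M -> Prop) : Prop := {
  vertices_set : is_set M V;
  vertices_nonempty : exists x, V x;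
  vertices_infinite : forall m, exists x, m < x /\ V x;
  edges_set : is_set M E;
  edges_pairs : forall a, E a -> exists x y, V x /\ V y /\ x < y /\ a = pair x y
}.

Definition adjacent {M : L2_structure} (E : num M -> Prop) (x y : num M)
    : Prop :=
  (x < y /\ E (pair x y)) \/ (y < x /\ E (pair y x)).

(** A path may have length 0. *)
Definition path_between {M : L2_structure} (V E : num M -> Prop) (x y : num M)
    : Prop :=
  exists p l : num M,
    finite_sequence p (l + 1) /\
    code_mem (pair 0 x) p /\
    code_mem (pair l y) p /\
    (forall i u, code_mem (pair i u) p -> V u) /\
    (forall i u v, i < l ->
       code_mem (pair i u) p -> code_mem (pair (i + 1) v) p -> adjacent E u v).

(** Components are nonempty: otherwise the empty set would be a component of
    every graph. *)
Record connected_component (M : L2_structure) (V E C : num M -> Prop)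
    : Prop := {
  component_set : is_set M C;
  component_nonempty : exists x, C x;
  component_vertices : forall x, C x -> V x;
  component_connected : forall x y, C x -> C y -> path_between V E x y;
  component_closed : forall x y, C x -> path_between V E x y -> C y
}.

Definition every_graph_has_component (M : L2_structure) : Prop :=
  forall V E, countable_graph M V E -> exists C, connected_component M V E C.

(** * Weak partitions *)

(** A function from N to N x N, as a set of pairs <s,<i,j>>. *)
Record enumerated_sequence (M : L2_structure) (D : num M -> Prop) : Prop := {
  enum_set : is_set M D;
  enum_pairs : forall a, D a -> exists s i j, a = pair s (pair i j);
  enum_function : forall s, exists! v, D (pair s v)
}.

(** [enum_mem D i j] is "j is in D_i". *)
Definition enum_mem {M : L2_structure} (D : num M -> Prop) (i j : num M)
    : Prop :=
  exists s, D (pair s (pair i j)).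

Definition enum_eq {M : L2_structure} (D : num M -> Prop) (i j : num M)
    : Prop :=
  forall n, enum_mem D i n <-> enum_mem D j n.

Definition enum_disjoint {M : L2_structure} (D : num M -> Prop) (i j : num M)
    : Prop :=
  forall n, ~ (enum_mem D i n /\ enum_mem D j n).

(** "D_i exists" as a set of the model. *)
Definition enum_exists {M : L2_structure} (D : num M -> Prop) (i : num M)
    : Prop :=
  exists X, is_set M X /\ forall j, X j <-> enum_mem D i j.

Record weak_partition (M : L2_structure) (D : num M -> Prop) : Prop := {
  weak_partition_enum : enumerated_sequence M D;
  weak_partition_cover : forall n, exists i, enum_mem D i n;
  weak_partition_blocks : forall i j, enum_eq D i j \/ enum_disjoint D i j
}.

Definition every_weak_partition_has_existing_block (M : L2_structure) : Prop :=
  forall D, weak_partition M D -> exists i, enum_exists D i.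

(* Main.v *)
(* A component yields a block: let the vertices be the elements <s,<i,n>> of the
   enumeration [D] itself, two of them being adjacent when they agree in [i] or
   in [n].  A path never leaves the block of its first vertex, since blocks that
   meet are equal; conversely two vertices of one block are joined by a path of
   length at most 2.  So the component C of <s,<i,n>> consists of the elements
   whose block is D_i, and since the blocks cover N, "m is in D_i" is equivalent
   both to "some <t,<j,m>> is in C" and to "all <t,<j,m>> in [D] are in C".

   A block yields a component: with v(n) the least vertex that is at least n,
   put j in D_i when a path joins v(i) to v(j).  Being (the code of) such a path
   is a bounded property, so these sets can be enumerated; v is the identity on
   vertices, so the vertices in D_i form a component. *)

From Stdlib Require Import Classical Arith Ring.
Require Import Defs.

Section ModelOfRCA0.

Context (M : L2_structure) (HM : RCA0 M).

Local Notation N := (num M).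
Local Notation env := (nat -> num M).

(** * Predicates defined by bounded formulas *)

Fixpoint rename_term (r : nat -> nat) (t : term) : term :=
  match t with
  | TVar k => TVar (r k)
  | TZero => TZero
  | TOne => TOne
  | TAdd t u => TAdd (rename_term r t) (rename_term r u)
  | TMul t u => TMul (rename_term r t) (rename_term r u)
  end.

Definition under_binder (r : nat -> nat) : nat -> nat :=
  fun k => match k with O => O | S k' => S (r k') end.

Fixpoint rename (r q : nat -> nat) (A : bformula) : bformula :=
  match A with
  | BEq t u => BEq (rename_term r t) (rename_term r u)
  | BLt t u => BLt (rename_term r t) (rename_term r u)
  | BMem t k => BMem (rename_term r t) (q k)
  | BNot A => BNot (rename r q A)
  | BAnd A B => BAnd (rename r q A) (rename r q B)
  | BOr A B => BOr (rename r q A) (rename r q B)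
  | BImp A B => BImp (rename r q A) (rename r q B)
  | BAll t A => BAll (rename_term r t) (rename (under_binder r) q A)
  | BEx t A => BEx (rename_term r t) (rename (under_binder r) q A)
  end.

Lemma teval_rename r (e e' : env) t :
  (forall k, e' (r k) = e k) -> teval M e' (rename_term r t) = teval M e t.
Proof. intros He; induction t; simpl; congruence. Qed.

Lemma bsat_rename A : forall r q s s' (e e' : env),
  (forall k, e' (r k) = e k) -> (forall k, s' (q k) = s k) ->
  (bsat M s' e' (rename r q A) <-> bsat M s e A).
Proof.
  assert (Hup : forall r (e e' : env) x, (forall k, e' (r k) = e k) ->
    forall k, scons x e' (under_binder r k) = scons x e k)
    by (intros r e e' x He [|k]; simpl; auto).
  induction A; intros r q s s' e e' He Hs; simpl;
    rewrite ?(teval_rename r e e' _ He), ?Hs; try tauto;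
    try (rewrite (IHA r q s s' e e' He Hs); tauto);
    try specialize (IHA1 r q s s' e e' He Hs);
    try specialize (IHA2 r q s s' e e' He Hs); try tauto.
  - split; intros H x Hx; specialize (H x Hx); revert H; apply IHA; auto.
  - split; intros (x & Hx & H); exists x; (split; [exact Hx|]);
      revert H; apply IHA; auto.
Qed.

Fixpoint mix {T : Type} (e p : nat -> T) (k : nat) : T :=
  match k with
  | O => e O
  | S O => p O
  | S (S k') => mix (fun i => e (S i)) (fun i => p (S i)) k'
  end.

Lemma mix_even T (e p : nat -> T) k : mix e p (2 * k)%nat = e k.
Proof.
  revert e p; induction k as [|k IH]; intros e p; [reflexivity|].
  replace (2 * S k)%nat with (S (S (2 * k)))%nat by ring.
  simpl mix; exact (IH _ _).
Qed.

Lemma mix_odd T (e p : nat -> T) k : mix e p (S (2 * k))%nat = p k.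
Proof.
  revert e p; induction k as [|k IH]; intros e p; [reflexivity|].
  replace (2 * S k)%nat with (S (S (2 * k)))%nat by ring.
  exact (IH _ _).
Qed.

(* [mix f g] applied to a position also serves as a renaming that acts as [f]
   on even and as [g] on odd positions. *)
Lemma mix_rename T (f g : nat -> nat) (e p h : nat -> T) :
  (forall k, h (f k) = e k) -> (forall k, h (g k) = p k) ->
  forall k, h (mix f g k) = mix e p k.
Proof.
  intros Hf Hg k.
  destruct (Nat.Even_or_Odd k) as [[j ->]|[j ->]].
  - rewrite !mix_even; auto.
  - rewrite Nat.add_1_r, !mix_odd; auto.
Qed.

(** Relocating the parameters along [r] touches odd positions only, so a formula keeps its variables
    when parameter lists are merged. *)
Lemma mix_pool T (e p p' : nat -> T) r : (forall k, p' (r k) = p k) ->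
  forall k, mix e p' (mix (fun i => 2 * i) (fun i => S (2 * r i)) k)%nat
            = mix e p k.
Proof.
  intros H; apply mix_rename; intros k; [apply mix_even|].
  rewrite mix_odd; auto.
Qed.

(* The values [p] of the parameters are kept in the odd positions, away from the
   variables of [e], so that two formulas can be given common parameters. *)
Definition polynomial_in (p : env) (f : env -> N) : Prop :=
  exists t, forall e, f e = teval M (mix e p) t.

Definition bounded_in (s : nat -> N -> Prop) (p : env) (P : env -> Prop) :
  Prop := exists A, forall e, P e <-> bsat M s (mix e p) A.

Lemma polynomial_in_pool p p' r f :
  (forall k, p' (r k) = p k) -> polynomial_in p f -> polynomial_in p' f.
Proof.
  intros Hr [t Ht].
  exists (rename_term (mix (fun i => 2 * i) (fun i => S (2 * r i)))%nat t).
  intros e; rewrite Ht; symmetry; apply teval_rename, mix_pool, Hr.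
Qed.

Lemma bounded_in_pool s s' q p p' r P :
  (forall k, s' (q k) = s k) -> (forall k, p' (r k) = p k) ->
  bounded_in s p P -> bounded_in s' p' P.
Proof.
  intros Hq Hr [A HA].
  exists (rename (mix (fun i => 2 * i) (fun i => S (2 * r i)))%nat q A).
  intros e; rewrite HA; symmetry; apply bsat_rename;
    [apply mix_pool, Hr|exact Hq].
Qed.

Definition polynomial (f : env -> N) : Prop := exists p, polynomial_in p f.

(** With the parameters hidden, boundedness can be proved connective by connective, without
    exhibiting de Bruijn formulas. *)
Definition bounded (P : env -> Prop) : Prop :=
  exists s p, (forall k, is_set M (s k)) /\ bounded_in s p P.

Lemma polynomial_pool2 f g : polynomial f -> polynomial g ->
  exists p, polynomial_in p f /\ polynomial_in p g.
Proof.
  intros [p Hp] [q Hq]; exists (mix p q); split.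
  - eapply polynomial_in_pool; [|exact Hp]; apply mix_even.
  - eapply polynomial_in_pool; [|exact Hq]; apply mix_odd.
Qed.

(** A binary connective needs both formulas over the same parameters; interleaving the two lists
    provides them. *)
Lemma bounded_pool2 P Q : bounded P -> bounded Q ->
  exists s p, (forall k, is_set M (s k)) /\
    bounded_in s p P /\ bounded_in s p Q.
Proof.
  intros (s & p & Hs & Hp) (s' & q & Hs' & Hq).
  exists (mix s s'), (mix p q); repeat split.
  - intros k; destruct (Nat.Even_or_Odd k) as [[j ->]|[j ->]].
    + rewrite mix_even; apply Hs.
    + rewrite Nat.add_1_r, mix_odd; apply Hs'.
  - eapply bounded_in_pool; [| |exact Hp]; apply mix_even.
  - eapply bounded_in_pool; [| |exact Hq]; apply mix_odd.
Qed.

Lemma polynomial_bounded_pool f P : polynomial f -> bounded P ->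
  exists s p, (forall k, is_set M (s k)) /\
    polynomial_in p f /\ bounded_in s p P.
Proof.
  intros [q Hq] (s & p & Hs & Hp).
  exists s, (mix p q); repeat split; [exact Hs| |].
  - eapply polynomial_in_pool; [|exact Hq]; apply mix_odd.
  - eapply (bounded_in_pool s s (fun k => k)); [| |exact Hp];
      [reflexivity|apply mix_even].
Qed.

(** * Closure properties of polynomial functions and bounded predicates *)

Lemma polynomial_var k : polynomial (fun e => e k).
Proof.
  exists (fun _ => 0), (TVar (2 * k)); intros e; simpl teval.
  symmetry; apply mix_even.
Qed.

Lemma polynomial_const c : polynomial (fun _ => c).
Proof. exists (fun _ => c), (TVar 1); reflexivity. Qed.

(** Serves for the shift under a binder, where an outer [f] becomes
    [fun e => f (fun k => e (S k))]. *)
Lemma polynomial_rename (r : nat -> nat) f :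
  polynomial f -> polynomial (fun e => f (fun k => e (r k))).
Proof.
  intros (p & t & Ht).
  exists p, (rename_term (mix (fun i => 2 * r i) (fun i => S (2 * i)))%nat t).
  intros e; rewrite Ht; symmetry; apply teval_rename, mix_rename; intros k.
  - apply mix_even.
  - apply mix_odd.
Qed.

Lemma polynomial_add f g :
  polynomial f -> polynomial g -> polynomial (fun e => f e + g e).
Proof.
  intros Hf Hg; destruct (polynomial_pool2 f g Hf Hg) as (p & [t Ht] & [u Hu]).
  exists p, (TAdd t u); intros e; simpl; congruence.
Qed.

Lemma polynomial_mul f g :
  polynomial f -> polynomial g -> polynomial (fun e => f e * g e).
Proof.
  intros Hf Hg; destruct (polynomial_pool2 f g Hf Hg) as (p & [t Ht] & [u Hu]).
  exists p, (TMul t u); intros e; simpl; congruence.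
Qed.

Lemma bounded_ext P Q : (forall e, P e <-> Q e) -> bounded P -> bounded Q.
Proof.
  intros H (s & p & Hs & A & HA); exists s, p; split; [exact Hs|].
  exists A; intros e; rewrite <- H; apply HA.
Qed.

Lemma bounded_eq f g :
  polynomial f -> polynomial g -> bounded (fun e => f e = g e).
Proof.
  intros Hf Hg; destruct (polynomial_pool2 f g Hf Hg) as (p & [t Ht] & [u Hu]).
  destruct (is_set_inhabited M) as [X HX].
  exists (fun _ => X), p; split; [auto|].
  exists (BEq t u); intros e; simpl; rewrite Ht, Hu; tauto.
Qed.

Lemma bounded_lt f g :
  polynomial f -> polynomial g -> bounded (fun e => f e < g e).
Proof.
  intros Hf Hg; destruct (polynomial_pool2 f g Hf Hg) as (p & [t Ht] & [u Hu]).
  destruct (is_set_inhabited M) as [X HX].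
  exists (fun _ => X), p; split; [auto|].
  exists (BLt t u); intros e; simpl; rewrite Ht, Hu; tauto.
Qed.

Lemma bounded_set X f :
  is_set M X -> polynomial f -> bounded (fun e => X (f e)).
Proof.
  intros HX (p & t & Ht); exists (fun _ => X), p; split; [auto|].
  exists (BMem t O); intros e; simpl; rewrite Ht; tauto.
Qed.

Lemma bounded_not P : bounded P -> bounded (fun e => ~ P e).
Proof.
  intros (s & p & Hs & A & HA); exists s, p; split; [exact Hs|].
  exists (BNot A); intros e; simpl; rewrite HA; tauto.
Qed.

Lemma bounded_and P Q : bounded P -> bounded Q -> bounded (fun e => P e /\ Q e).
Proof.
  intros HP HQ; destruct (bounded_pool2 P Q HP HQ)
    as (s & p & Hs & [A HA] & [B HB]).
  exists s, p; split; [exact Hs|].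
  exists (BAnd A B); intros e; simpl; rewrite HA, HB; tauto.
Qed.

Lemma bounded_or P Q : bounded P -> bounded Q -> bounded (fun e => P e \/ Q e).
Proof.
  intros HP HQ; destruct (bounded_pool2 P Q HP HQ)
    as (s & p & Hs & [A HA] & [B HB]).
  exists s, p; split; [exact Hs|].
  exists (BOr A B); intros e; simpl; rewrite HA, HB; tauto.
Qed.

Lemma bounded_imp P Q : bounded P -> bounded Q -> bounded (fun e => P e -> Q e).
Proof.
  intros HP HQ; destruct (bounded_pool2 P Q HP HQ)
    as (s & p & Hs & [A HA] & [B HB]).
  exists s, p; split; [exact Hs|].
  exists (BImp A B); intros e; simpl; rewrite HA, HB; tauto.
Qed.

Lemma bounded_iff P Q :
  bounded P -> bounded Q -> bounded (fun e => P e <-> Q e).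
Proof.
  intros HP HQ; unfold iff; apply bounded_and; apply bounded_imp; assumption.
Qed.

(** By excluded middle, a statement about fixed objects only can be replaced by a true or a false
    equation. *)
Lemma bounded_prop (P : Prop) : bounded (fun _ => P).
Proof.
  destruct (classic P) as [H|H].
  - apply (bounded_ext (fun e => e O = e O)); [tauto|].
    apply bounded_eq; apply polynomial_var.
  - apply (bounded_ext (fun e => ~ e O = e O)); [tauto|].
    apply bounded_not, bounded_eq; apply polynomial_var.
Qed.

(* The bound variable has to move in front of the parameters: it is variable 0
   of [e] in [mix e p], and position 0 of [scons x (mix e p)]. *)
Lemma bounded_in_binder s p (R : N -> env -> Prop) :
  bounded_in s p (fun e => R (e O) (fun k => e (S k))) ->
  exists A, forall x e, R x e <-> bsat M s (scons x (mix e p)) A.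
Proof.
  intros [A HA].
  exists (rename (mix (fun i => match i with O => O | S j => S (2 * j) end)
                      (fun i => S (S (2 * i))))%nat (fun k => k) A).
  intros x e; specialize (HA (scons x e)); simpl in HA; rewrite HA.
  symmetry; apply bsat_rename; [|reflexivity].
  apply mix_rename.
  - intros [|k]; [reflexivity|]; apply (mix_even _ e p).
  - intros k; apply (mix_odd _ e p).
Qed.

Lemma bounded_all f R :
  polynomial f -> bounded (fun e => R (e O) (fun k => e (S k))) ->
  bounded (fun e => forall x, x < f e -> R x e).
Proof.
  intros Hf HR; destruct (polynomial_bounded_pool _ _ Hf HR)
    as (s & p & Hs & [t Ht] & HA); clear Hf HR.
  destruct (bounded_in_binder _ _ _ HA) as [A HA']; clear HA.
  exists s, p; split; [exact Hs|]; exists (BAll t A); intros e; simpl.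
  rewrite <- Ht; split; intros H x Hx; apply HA', H, Hx.
Qed.

Lemma bounded_ex f R :
  polynomial f -> bounded (fun e => R (e O) (fun k => e (S k))) ->
  bounded (fun e => exists x, x < f e /\ R x e).
Proof.
  intros Hf HR; destruct (polynomial_bounded_pool _ _ Hf HR)
    as (s & p & Hs & [t Ht] & HA); clear Hf HR.
  destruct (bounded_in_binder _ _ _ HA) as [A HA']; clear HA.
  exists s, p; split; [exact Hs|]; exists (BEx t A); intros e; simpl.
  rewrite <- Ht; split; intros (x & Hx & H); exists x; (split; [exact Hx|]);
    apply HA', H.
Qed.

(** Codes and paths are defined with unbounded quantifiers. Such a quantifier can be bounded when
    all instances beyond a polynomial hold anyway. *)
Lemma bounded_all_below f R :
  polynomial f -> (forall e x, ~ x < f e -> R x e) ->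
  bounded (fun e => R (e O) (fun k => e (S k))) ->
  bounded (fun e => forall x, R x e).
Proof.
  intros Hf Hout HR.
  apply (bounded_ext (fun e => forall x, x < f e -> R x e));
    [|apply bounded_all; assumption].
  intros e; split; [|auto]; intros H x.
  destruct (classic (x < f e)); auto.
Qed.

Lemma bounded_ex_below f R :
  polynomial f -> (forall e x, R x e -> x < f e) ->
  bounded (fun e => R (e O) (fun k => e (S k))) ->
  bounded (fun e => exists x, R x e).
Proof.
  intros Hf Hin HR.
  apply (bounded_ext (fun e => exists x, x < f e /\ R x e));
    [|apply bounded_ex; assumption].
  intros e; split; intros [x Hx]; exists x; [tauto|auto].
Qed.

(* The variables [x] and [n] are moved to the places where [Sigma01_sat] expects
   them; the other variables of [R], which do not matter, all go to 0. *)
Lemma bounded_in_matrix s p (R : N -> N -> Prop) :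
  bounded_in s p (fun e => R (e O) (e 1%nat)) ->
  exists A, forall x n,
    bsat M s (scons x (scons n (scons 0 p))) A <-> R x n.
Proof.
  intros [A HA].
  exists (rename (mix (fun i => match i with O => 0 | S O => 1 | _ => 2 end)
                      (fun i => 3 + i))%nat (fun k => k) A).
  intros x n.
  specialize (HA (scons x (scons n (fun _ => 0)))); simpl in HA; rewrite HA.
  apply bsat_rename; [|reflexivity].
  apply mix_rename; [intros [|[|k]]|]; reflexivity.
Qed.

(** * Induction and comprehension for bounded predicates *)

Lemma Sigma_ind (R : N -> N -> Prop) :
  bounded (fun e => R (e O) (e 1%nat)) ->
  (exists x, R x 0) ->
  (forall n x, R x n -> exists y, R y (n + 1)) ->
  forall n, exists x, R x n.
Proof.
  intros (s & p & Hs & HR) H0 HS.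
  destruct (bounded_in_matrix s p R HR) as [A HA].
  intros n.
  assert (H : Sigma01_sat M s (scons n (scons 0 p)) A).
  { revert n; apply (RCA0_induction M HM); [exact Hs| |].
    - destruct H0 as [x Hx]; exists x; apply HA, Hx.
    - intros n [x Hx]; apply HA, HS in Hx.
      destruct Hx as [y Hy]; exists y; apply HA, Hy. }
  destruct H as [x Hx]; exists x; apply HA, Hx.
Qed.

(** A dummy existential quantifier reduces this to [Sigma_ind]; it occupies variable 0, which is why
    [P] is about variable 1. *)
Lemma bounded_ind (P : N -> Prop) :
  bounded (fun e => P (e 1%nat)) ->
  P 0 -> (forall n, P n -> P (n + 1)) -> forall n, P n.
Proof.
  intros HP H0 HS n.
  enough (exists _ : N, P n) as [_ ?] by assumption.
  revert n; apply (Sigma_ind (fun _ n => P n)); [exact HP|exists 0; exact H0|].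
  intros n _ Hn; exists 0; auto.
Qed.

Lemma Delta_comprehension (P : N -> Prop) (R S : N -> N -> Prop) :
  bounded (fun e => R (e O) (e 1%nat)) ->
  bounded (fun e => S (e O) (e 1%nat)) ->
  (forall n, P n <-> exists x, R x n) ->
  (forall n, P n <-> forall x, S x n) ->
  exists X, is_set M X /\ forall n, X n <-> P n.
Proof.
  intros HR HS HPR HPS.
  (* The comprehension axiom evaluates both matrices under the same parameters. *)
  destruct (bounded_pool2 _ _ HR HS) as (s & p & Hs & HR' & HS').
  destruct (bounded_in_matrix _ _ _ HR') as [A HA].
  destruct (bounded_in_matrix _ _ _ HS') as [B HB].
  assert (HA' : forall n, Sigma01_sat M s (scons n (scons 0 p)) A <-> P n).
  { intros n; rewrite HPR; split; intros [x Hx]; exists x; apply HA, Hx. }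
  destruct (RCA0_comprehension M HM A B s (scons 0 p) Hs) as (X & HX & HXn).
  - intros n; rewrite HA', HPS.
    split; intros H x; apply HB, H.
  - exists X; split; [exact HX|]; intros n; rewrite HXn; apply HA'.
Qed.

Lemma bounded_comprehension (P : N -> Prop) :
  bounded (fun e => P (e 1%nat)) ->
  exists X, is_set M X /\ forall n, X n <-> P n.
Proof.
  intros HP; apply (Delta_comprehension P (fun _ n => P n) (fun _ n => P n));
    trivial; intros n; split; auto; [exists 0; assumption|firstorder].
Qed.

Ltac polynomial :=
  cbv beta;
  first [ assumption | apply polynomial_const | apply polynomial_var
        | apply polynomial_add; polynomial
        | apply polynomial_mul; polynomial
        | apply polynomial_rename; assumption ].

(** Extended below whenever a further predicate has been shown to be bounded. *)
Ltac bounded_leaf := fail.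

Ltac bounded :=
  cbv beta;
  first [ apply bounded_prop
        | assumption
        | bounded_leaf
        | apply bounded_iff; bounded
        | apply bounded_and; bounded
        | apply bounded_or; bounded
        | apply bounded_not; bounded
        | apply bounded_imp; bounded
        | apply bounded_ex; [polynomial|bounded]
        | apply bounded_all; [polynomial|bounded]
        | apply bounded_eq; polynomial
        | apply bounded_lt; polynomial
        | apply bounded_set; [assumption|polynomial] ].

Ltac induct :=
  match goal with
  | |- forall n, @?P n => apply (bounded_ind P); [bounded|cbv beta|cbv beta]
  end.

Let Hb := RCA0_basic M HM.

(** * Arithmetic *)

Lemma add_assoc (x y z : N) : x + (y + z) = (x + y) + z.
Proof.
  revert z; induct.
  - now rewrite !(add_zero M Hb).
  - intros z IH; now rewrite !(add_succ M Hb), IH.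
Qed.

Lemma zero_add (x : N) : 0 + x = x.
Proof.
  revert x; induct; [apply (add_zero M Hb)|].
  intros x IH; now rewrite (add_succ M Hb), IH.
Qed.

Lemma one_add (x : N) : 1 + x = x + 1.
Proof.
  revert x; induct; [now rewrite (add_zero M Hb), zero_add|].
  intros x IH; now rewrite (add_succ M Hb), IH.
Qed.

Lemma add_comm (x y : N) : x + y = y + x.
Proof.
  revert y; induct; [now rewrite (add_zero M Hb), zero_add|].
  intros y IH; rewrite (add_succ M Hb), IH.
  now rewrite <- (add_assoc y 1 x), one_add, add_assoc.
Qed.

Lemma mul_add (x y z : N) : x * (y + z) = x * y + x * z.
Proof.
  revert z; induct.
  - now rewrite (mul_zero M Hb), !(add_zero M Hb).
  - intros z IH; now rewrite (add_succ M Hb), !(mul_succ M Hb), IH, add_assoc.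
Qed.

Lemma mul_assoc (x y z : N) : x * (y * z) = (x * y) * z.
Proof.
  revert z; induct.
  - now rewrite !(mul_zero M Hb).
  - intros z IH; now rewrite !(mul_succ M Hb), mul_add, IH.
Qed.

Lemma zero_mul (x : N) : 0 * x = 0.
Proof.
  revert x; induct; [apply (mul_zero M Hb)|].
  intros x IH; now rewrite (mul_succ M Hb), IH, (add_zero M Hb).
Qed.

Lemma one_mul (x : N) : 1 * x = x.
Proof.
  revert x; induct; [apply (mul_zero M Hb)|].
  intros x IH; now rewrite (mul_succ M Hb), IH.
Qed.

Lemma add_mul (x y z : N) : (x + y) * z = x * z + y * z.
Proof.
  revert z; induct; [now rewrite !(mul_zero M Hb), (add_zero M Hb)|].
  intros z IH; rewrite !(mul_succ M Hb), IH, <- !add_assoc; f_equal.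
  rewrite !add_assoc; f_equal; apply add_comm.
Qed.

Lemma mul_comm (x y : N) : x * y = y * x.
Proof.
  revert y; induct; [now rewrite (mul_zero M Hb), zero_mul|].
  intros y IH; now rewrite (mul_succ M Hb), IH, add_mul, one_mul.
Qed.

Lemma num_semi_ring :
  semi_ring_theory (zero : N) one (@add M) (@mul M) (@eq N).
Proof.
  constructor; auto using zero_add, add_comm, add_assoc, one_mul, zero_mul,
    mul_comm, mul_assoc, add_mul.
Qed.

Add Ring num_ring : num_semi_ring.

(** Written with [<] only, so that it is an atomic formula of the language. *)
Local Notation "x <= y" := (x < y + 1) : L2_scope.

Lemma lt_iff (x y : N) : x < y <-> exists z, y = x + z + 1.
Proof.
  split.
  - intros Hxy.
    (* With the premise inside the existential, the statement is Sigma^0_1 in [y] and can be proved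
       by induction. *)
    assert (H : exists z, x < y -> y = x + z + 1).
    { clear Hxy; revert y; apply Sigma_ind; [bounded| |].
      - exists 0; intros H; destruct (not_lt_zero M Hb _ H).
      - intros y z IH; destruct (classic (x < y)) as [H|H].
        + exists (z + 1); intros _; rewrite (IH H); ring.
        (* Only [x = y] is left here, and then the difference sought is 0. *)
        + exists 0; intros H'; apply (lt_succ M Hb) in H'.
          destruct H' as [H'|H']; [tauto|]; rewrite H'; ring. }
    destruct H as [z Hz]; eauto.
  - intros [z ->]; revert z; induct; [|intros z IH]; apply (lt_succ M Hb).
    + right; ring.
    + left; now rewrite add_assoc.
Qed.

Lemma le_iff (x y : N) : x <= y <-> exists z, y = x + z.
Proof.
  rewrite lt_iff; split; intros [z Hz]; exists z.
  - apply (succ_inj M Hb); exact Hz.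
  - now rewrite Hz.
Qed.

Lemma add_cancel (x y z : N) : z + x = z + y -> x = y.
Proof.
  rewrite !(add_comm z); revert z; induct; [now rewrite !(add_zero M Hb)|].
  intros z IH H; apply IH, (succ_inj M Hb); now rewrite <- !add_assoc.
Qed.

Lemma zero_or_succ (x : N) : x = 0 \/ exists y, x = y + 1.
Proof.
  (* The bound on the predecessor makes the statement bounded, as the induction requires. *)
  destruct (classic (exists y, y < x + 1 /\ x = y + 1)) as [(y & _ & H)|H];
    [eauto|left].
  revert x H; induct; [reflexivity|].
  intros x _ H; destruct H; exists x; split; [|reflexivity].
  apply lt_iff; exists 1; ring.
Qed.

Lemma zero_sum (x y : N) : 0 = x + y -> x = 0 /\ y = 0.
Proof.
  destruct (zero_or_succ y) as [->|[z ->]].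
  - rewrite (add_zero M Hb); auto.
  - intros H; destruct (succ_neq_zero M Hb (x + z)); rewrite H; ring.
Qed.

Lemma lt_irrefl (x : N) : ~ x < x.
Proof.
  rewrite lt_iff; intros [z Hz].
  apply (succ_neq_zero M Hb z), (add_cancel _ _ x); rewrite Hz at 2; ring.
Qed.

Lemma le_or_lt (x y : N) : x <= y \/ y < x.
Proof.
  revert x; induct.
  - left; apply le_iff; exists y; ring.
  - intros x [H|H].
    + apply le_iff in H; destruct H as [z ->].
      destruct (zero_or_succ z) as [->|[z' ->]].
      * right; apply lt_iff; exists 0; ring.
      * left; apply le_iff; exists z'; ring.
    + right; apply (lt_succ M Hb); auto.
Qed.

Lemma lt_total (x y : N) : x < y \/ x = y \/ y < x.
Proof.
  destruct (le_or_lt x y) as [H|H]; [apply (lt_succ M Hb) in H|]; tauto.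
Qed.

Lemma lt_trans (x y z : N) : x < y -> y < z -> x < z.
Proof.
  rewrite !lt_iff; intros [u ->] [v ->]; exists (u + v + 1); ring.
Qed.

Lemma le_lt_trans (x y z : N) : x <= y -> y < z -> x < z.
Proof.
  rewrite le_iff, !lt_iff; intros [u ->] [v ->]; exists (u + v); ring.
Qed.

Lemma lt_le_trans (x y z : N) : x < y -> y <= z -> x < z.
Proof.
  rewrite le_iff, !lt_iff; intros [u ->] [v ->]; exists (u + v); ring.
Qed.

Lemma zero_le (x : N) : 0 <= x.
Proof. apply le_iff; exists x; ring. Qed.

Lemma le_add (x y : N) : x <= x + y.
Proof. apply le_iff; exists y; ring. Qed.

Lemma le_refl (x : N) : x <= x.
Proof. apply (lt_succ M Hb); auto. Qed.

(** If there were no least element, the absence of elements below [n] would pass from [n] to [n + 1]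
    by bounded induction. *)
Lemma least_element (P : N -> Prop) :
  bounded (fun e => P (e O)) -> (exists x, P x) ->
  exists x, P x /\ forall z, z < x -> ~ P z.
Proof.
  intros HP [x Hx]; apply NNPP; intros Hno.
  assert (H : forall n z, z < n -> ~ P z).
  { induct.
    - intros z Hz; destruct (not_lt_zero M Hb _ Hz).
    - intros n IH z Hz HPz; apply (lt_succ M Hb) in Hz.
      destruct Hz as [Hz| ->]; [exact (IH z Hz HPz)|].
      apply Hno; exists n; auto. }
  exact (H (x + 1) x (le_refl x) Hx).
Qed.

(** * Pairs and codes of finite sets *)

(** The square dominates: (x+y)^2 + x is less than (x+y+1)^2. The sum of the components can
    therefore be recovered from the pair. *)
Lemma pair_sum_mono (x y x' y' : N) :
  x + y < x' + y' -> pair x y < pair x' y'.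
Proof.
  unfold pair; rewrite lt_iff; intros [z ->].
  apply lt_iff.
  exists ((x + y) * z + (x + y) * z + x + y + y + z * z + z + z + x').
  ring.
Qed.

Lemma pair_inj (x y x' y' : N) : pair x y = pair x' y' -> x = x' /\ y = y'.
Proof.
  intros H.
  destruct (lt_total (x + y) (x' + y')) as [Hlt|[Heq|Hlt]].
  - apply pair_sum_mono in Hlt; rewrite H in Hlt; destruct (lt_irrefl _ Hlt).
  - unfold pair in H; rewrite Heq in H; apply add_cancel in H; subst x'.
    split; [reflexivity|]; exact (add_cancel _ _ _ Heq).
  - apply pair_sum_mono in Hlt; rewrite H in Hlt; destruct (lt_irrefl _ Hlt).
Qed.

Lemma pair_mono (x y x' y' : N) : x <= x' -> y <= y' -> pair x y <= pair x' y'.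
Proof.
  rewrite !le_iff; intros [u ->] [v ->]; unfold pair.
  exists ((x + y) * (u + v) + (x + y) * (u + v) + (u + v) * (u + v) + u); ring.
Qed.

Lemma le_pair_l (x y : N) : x <= pair x y.
Proof. apply le_iff; exists ((x + y) * (x + y)); unfold pair; ring. Qed.

Lemma le_pair_r (x y : N) : y <= pair x y.
Proof.
  destruct (zero_or_succ y) as [->|[z ->]]; [apply zero_le|].
  apply le_iff; unfold pair.
  exists (x * x + x * z + x + x * z + x + z * z + z + x); ring.
Qed.

Definition divides (a b : N) : Prop := exists q, b = q * a.

Lemma divides_add_cancel (a b c : N) :
  divides a (b + c) -> divides a b -> divides a c.
Proof.
  intros [q Hq] [r ->].
  destruct (le_or_lt r q) as [H|H].
  - apply le_iff in H; destruct H as [d ->]; exists d.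
    apply (add_cancel _ _ (r * a)); rewrite Hq; ring.
  (* Here q < r, and q * a = r * a + c is possible only with c = 0. *)
  - apply lt_iff in H; destruct H as [d ->]; exists 0.
    assert (H : 0 = (d * a + a) + c).
    { apply (add_cancel _ _ (q * a)).
      transitivity (q * a); [ring|].
      rewrite <- Hq at 1; ring. }
    apply zero_sum in H; destruct H as [_ ->]; ring.
Qed.

Lemma divides_mul (a b c : N) : divides a b -> divides a (c * b).
Proof. intros [q ->]; exists (c * q); ring. Qed.

(* With a_i = m(i+1)+1: (i+1)a_j - (j+1)a_i = i-j, so a_j divides (i-j)y, hence
   m(j+1)y, and m(j+1) is -1 modulo a_j. *)
Lemma divides_other_modulus (m k i j y : N) :
  (forall d, d < k -> divides (d + 1) m) -> i < k -> j < k -> i <> j ->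
  divides (m * (j + 1) + 1) ((m * (i + 1) + 1) * y) ->
  divides (m * (j + 1) + 1) y.
Proof.
  intros Hm Hi Hj Hij Hdiv.
  set (a := m * (j + 1) + 1) in *.
  (* In either order of [i] and [j], [d + 1] is their distance, and [d < k] makes it a divisor of
     [m]. *)
  assert (H : exists d, d < k /\ divides a ((d + 1) * y)).
  { destruct (lt_total i j) as [H|[H|H]]; [|tauto|];
      apply lt_iff in H; destruct H as [d Hd]; exists d; subst.
    - split; [apply (le_lt_trans _ (i + d + 1)); [|exact Hj]|].
      { apply le_iff; exists (i + 1); ring. }
      apply (divides_add_cancel _ ((i + 1) * y * a)).
      + replace ((i + 1) * y * a + (d + 1) * y)
          with ((i + d + 1 + 1) * ((m * (i + 1) + 1) * y)) by (subst a; ring).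
        apply divides_mul, Hdiv.
      + exists ((i + 1) * y); reflexivity.
    - split; [apply (le_lt_trans _ (j + d + 1)); [|exact Hi]|].
      { apply le_iff; exists (j + 1); ring. }
      apply (divides_add_cancel _ ((j + 1) * ((m * (j + d + 1 + 1) + 1) * y))).
      + exists ((j + d + 1 + 1) * y); subst a; ring.
      + apply divides_mul, Hdiv. }
  destruct H as (d & Hd & H); destruct (Hm d Hd) as [r Hr].
  apply (divides_add_cancel _ ((j + 1) * (r * ((d + 1) * y)))).
  - exists y; subst a; rewrite Hr; ring.
  - apply divides_mul, divides_mul, H.
Qed.

Lemma bounded_divides f g :
  polynomial f -> polynomial g -> bounded (fun e => divides (f e) (g e)).
Proof.
  intros Hf Hg.
  (* A positive number is at least its quotients; [0] has quotient [0]. *)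
  apply (bounded_ext (fun e => exists q, q < g e + 1 /\ g e = q * f e)).
  - intros e; split; [intros (q & _ & H); exists q; exact H|intros [q H]].
    destruct (zero_or_succ (f e)) as [Hz|[d Hd]].
    + exists 0; split; [apply zero_le|]; rewrite H, Hz; ring.
    + exists q; split; [|exact H]; apply le_iff; exists (q * d).
      rewrite H, Hd; ring.
  - bounded.
Qed.

Ltac bounded_leaf ::= apply bounded_divides; polynomial.

(** [m] plays the role of k!. Its positivity makes every modulus m(j+1)+1 exceed 1. *)
Lemma common_multiple (k : N) :
  exists m, 0 < m /\ forall j, j < k -> divides (j + 1) m.
Proof.
  revert k; apply Sigma_ind; [bounded| |].
  - exists 1; split; [apply lt_iff; exists 0; ring|].
    intros j Hj; destruct (not_lt_zero M Hb _ Hj).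
  - intros k m [Hm Hdiv]; exists (m * (k + 1)); split.
    + apply lt_iff in Hm; destruct Hm as [d ->].
      apply lt_iff; exists (d * k + d + k); ring.
    + intros j Hj; apply (lt_succ M Hb) in Hj; destruct Hj as [Hj| ->].
      * rewrite mul_comm; apply divides_mul, Hdiv, Hj.
      * exists m; reflexivity.
Qed.

(** Goedel's coding: [n] is the product of the moduli m(i+1)+1 over the members i < k of [X]. By
    [divides_other_modulus], the moduli of the other indices below [k] do not divide it. *)
Lemma finite_set_code (X : N -> Prop) (k : N) :
  is_set M X -> exists c, forall i, code_mem i c <-> i < k /\ X i.
Proof.
  intros HX; destruct (common_multiple k) as (m & Hm & Hdiv).
  (* Partial products up to [l]; keeping [l <= k] inside the existential leaves the statement
     Sigma^0_1. *)
  assert (Hprod : forall l, exists n, l <= k ->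
    (forall i, i < l -> X i -> divides (m * (i + 1) + 1) n) /\
    (forall j, j < k -> divides (m * (j + 1) + 1) n -> X j /\ j < l)).
  { apply Sigma_ind; [bounded| |].
    (* The empty product: no modulus divides 1, since [m] is positive. *)
    - exists 1; intros _; split.
      + intros i Hi; destruct (not_lt_zero M Hb _ Hi).
      + intros j _ [q Hq]; exfalso.
        apply lt_iff in Hm; destruct Hm as [d Hd].
        destruct (zero_or_succ q) as [->|[q' ->]].
        * apply (succ_neq_zero M Hb 0); rewrite zero_add, Hq; ring.
        * apply (lt_irrefl 1); rewrite Hq at 2; rewrite Hd.
          apply lt_iff.
          exists (q' * ((0 + d + 1) * (j + 1) + 1) + d * j + d + j); ring.
    - intros l n IH.
      destruct (le_or_lt (l + 1) k) as [Hl|Hl];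
        [|exists 0; intros H; destruct (lt_irrefl _ (le_lt_trans _ _ _ H Hl))].
      assert (Hlk : l < k).
      { apply le_iff in Hl; destruct Hl as [d ->].
        apply lt_iff; exists d; ring. }
      destruct IH as [IH1 IH2]; [exact (lt_trans _ _ _ Hlk (le_refl k))|].
      destruct (classic (X l)) as [HXl|HXl].
      + exists ((m * (l + 1) + 1) * n); intros _; split.
        * intros i Hi HXi; apply (lt_succ M Hb) in Hi; destruct Hi as [Hi| ->].
          -- apply divides_mul, IH1; assumption.
          -- exists n; ring.
        * intros j Hj H; destruct (classic (l = j)) as [<-|Hlj].
          -- split; [exact HXl|apply le_refl].
          (* The new factor has an index other than [j], so the modulus of [j] already divides the
             old product. *)
          -- apply (divides_other_modulus m k l j n) in H; try assumption.
             destruct (IH2 j Hj H) as [HXj Hjl].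
             split; [exact HXj|apply (lt_succ M Hb); auto].
      + exists n; intros _; split.
        * intros i Hi HXi; apply (lt_succ M Hb) in Hi; destruct Hi as [Hi| ->].
          -- exact (IH1 i Hi HXi).
          -- tauto.
        * intros j Hj H; destruct (IH2 j Hj H) as [HXj Hjl].
          split; [exact HXj|apply (lt_succ M Hb); auto]. }
  destruct (Hprod k) as [n Hn].
  destruct (Hn (le_refl k)) as [Hn1 Hn2].
  exists (pair k (pair m n)); intros i; split.
  - intros (k' & m' & n' & Heq & Hi & q & Hq).
    apply pair_inj in Heq; destruct Heq as [<- Heq].
    apply pair_inj in Heq; destruct Heq as [<- <-].
    split; [exact Hi|]; apply Hn2; [exact Hi|exists q; exact Hq].
  - intros [Hi HXi]; exists k, m, n; repeat split; [exact Hi|].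
    exact (Hn1 i Hi HXi).
Qed.

(** This bound and the next two turn quantifiers over the entries of a code into bounded ones. *)
Lemma code_mem_lt (i c : N) : code_mem i c -> i < c.
Proof.
  intros (k & m & n & -> & Hi & _).
  exact (lt_le_trans _ _ _ Hi (le_pair_l _ _)).
Qed.

Lemma code_mem_index_lt (i u c : N) : code_mem (pair i u) c -> i < c.
Proof.
  intros H; exact (le_lt_trans _ _ _ (le_pair_l i u) (code_mem_lt _ _ H)).
Qed.

Lemma code_mem_value_lt (i u c : N) : code_mem (pair i u) c -> u < c.
Proof.
  intros H; exact (le_lt_trans _ _ _ (le_pair_r i u) (code_mem_lt _ _ H)).
Qed.

(** The components [k], [m], [n] are at most the code itself, and the remaining quantifier is that
    of [divides]. *)
Lemma bounded_code_mem f g :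
  polynomial f -> polynomial g -> bounded (fun e => code_mem (f e) (g e)).
Proof.
  intros Hf Hg; unfold code_mem.
  apply (bounded_ex_below (fun e => g e + 1)); [polynomial| |].
  { intros e k (m & n & -> & _); apply le_pair_l. }
  cbv beta.
  apply (bounded_ex_below (fun e => g (fun k => e (S k)) + 1)); [polynomial| |].
  { intros e m (n & -> & _).
    apply (le_lt_trans _ _ _ (le_pair_l m n)).
    exact (le_lt_trans _ _ _ (le_pair_r _ _) (le_refl _)). }
  cbv beta.
  apply (bounded_ex_below (fun e => g (fun k => e (S (S k))) + 1));
    [polynomial| |].
  { intros e n (-> & _).
    apply (le_lt_trans _ _ _ (le_pair_r (e O) n)).
    exact (le_lt_trans _ _ _ (le_pair_r _ _) (le_refl _)). }
  cbv beta; apply bounded_and; [unfold pair; bounded|].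
  apply bounded_and; [bounded|].
  apply (bounded_divides
    (fun e => e 1%nat * (f (fun k => e (S (S (S k)))) + 1) + 1) (fun e => e O));
    polynomial.
Qed.

Ltac bounded_leaf ::=
  first [ apply bounded_divides; polynomial
        | apply bounded_code_mem; polynomial ].

(** * Paths *)

Lemma bounded_finite_sequence f g :
  polynomial f -> polynomial g ->
  bounded (fun e => finite_sequence (f e) (g e)).
Proof.
  intros Hf Hg; unfold finite_sequence.
  apply bounded_and; [|apply bounded_and].
  - apply (bounded_all_below f); [polynomial| |].
    { intros e a Ha H; destruct Ha; apply code_mem_lt, H. }
    apply bounded_imp; [bounded|cbv beta].
    apply (bounded_ex_below (fun e => e O + 1)); [polynomial| |].
    { intros e i [u ->]; apply le_pair_l. }
    cbv beta; apply (bounded_ex_below (fun e => e 1%nat + 1)); [polynomial| |].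
    { intros e u ->; apply le_pair_r. }
    bounded.
  - apply (bounded_all_below f); [polynomial| |].
    { intros e i Hi u v H; destruct Hi; eapply code_mem_index_lt, H. }
    cbv beta.
    apply (bounded_all_below (fun e => f (fun k => e (S k)))); [polynomial| |].
    { intros e u Hu v H; destruct Hu; eapply code_mem_value_lt, H. }
    cbv beta.
    apply (bounded_all_below (fun e => f (fun k => e (S (S k)))));
      [polynomial| |].
    { intros e v Hv _ H; destruct Hv; eapply code_mem_value_lt, H. }
    bounded.
  (* Beyond both the code and the length, the two sides of the equivalence are false; the sum is a
     polynomial above both. *)
  - apply (bounded_all_below (fun e => f e + g e)); [polynomial| |].
    { intros e i Hi; split; [intros H|intros [u H]]; destruct Hi.
      - apply (lt_le_trans _ _ _ H); rewrite (add_comm (f e)); apply le_add.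
      - apply code_mem_index_lt in H.
        exact (lt_le_trans _ _ _ H (le_add _ _)). }
    cbv beta; apply bounded_iff; [bounded|].
    apply (bounded_ex_below (fun e => f (fun k => e (S k)))); [polynomial| |].
    { intros e u H; eapply code_mem_value_lt, H. }
    bounded.
Qed.

(** The matrix of [path_between]: once the code and the length are given, the condition is
    bounded. *)
Definition path_code (V E : N -> Prop) (p l x y : N) : Prop :=
  finite_sequence p (l + 1) /\
  code_mem (pair 0 x) p /\
  code_mem (pair l y) p /\
  (forall i u, code_mem (pair i u) p -> V u) /\
  (forall i u v, i < l ->
     code_mem (pair i u) p -> code_mem (pair (i + 1) v) p -> adjacent E u v).

Lemma bounded_path_code V E f g x y :
  is_set M V -> is_set M E ->
  polynomial f -> polynomial g -> polynomial x -> polynomial y ->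
  bounded (fun e => path_code V E (f e) (g e) (x e) (y e)).
Proof.
  intros HV HE Hf Hg Hx Hy; unfold path_code.
  apply bounded_and; [|apply bounded_and; [|apply bounded_and;
    [|apply bounded_and]]].
  - apply (bounded_finite_sequence f (fun e => g e + 1)); polynomial.
  - bounded.
  - bounded.
  - apply (bounded_all_below f); [polynomial| |].
    { intros e i Hi u H; destruct Hi; eapply code_mem_index_lt, H. }
    cbv beta.
    apply (bounded_all_below (fun e => f (fun k => e (S k)))); [polynomial| |].
    { intros e u Hu H; destruct Hu; eapply code_mem_value_lt, H. }
    bounded.
  - apply (bounded_all_below f); [polynomial| |].
    { intros e i Hi u v _ H; destruct Hi; eapply code_mem_index_lt, H. }
    cbv beta.
    apply (bounded_all_below (fun e => f (fun k => e (S k)))); [polynomial| |].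
    { intros e u Hu v _ H; destruct Hu; eapply code_mem_value_lt, H. }
    cbv beta.
    apply (bounded_all_below (fun e => f (fun k => e (S (S k)))));
      [polynomial| |].
    { intros e v Hv _ _ H; destruct Hv; eapply code_mem_value_lt, H. }
    unfold adjacent; bounded.
Qed.

Ltac bounded_leaf ::=
  first [ apply bounded_divides; polynomial
        | apply bounded_code_mem; polynomial
        | apply bounded_path_code; [assumption|assumption|polynomial..] ].

(** All paths below are built this way: comprehension turns the bounded relation [R] into a set of
    pairs, of which [finite_set_code] codes a large enough part. *)
Lemma path_of_relation (V E : N -> Prop) (R : N -> N -> Prop) (x y l b : N) :
  bounded (fun e => R (e 1%nat) (e O)) ->
  (forall i, i <= l -> exists u, R i u) ->
  (forall i u v, R i u -> R i v -> u = v) ->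
  (forall i u, R i u -> i <= l /\ u <= b /\ V u) ->
  R 0 x -> R l y ->
  (forall i u v, i < l -> R i u -> R (i + 1) v -> adjacent E u v) ->
  path_between V E x y.
Proof.
  intros HR Htot Hfun Hrange Hx Hy Hadj.
  destruct (bounded_comprehension (fun a =>
    exists i, i < a + 1 /\ exists u, u < a + 1 /\ (a = pair i u /\ R i u)))
    as (X & HX & HXa); [bounded|].
  (* By [pair_mono], every pair <i,u> with i <= l and u <= b lies below this bound. *)
  destruct (finite_set_code X (pair l b + 1) HX) as [c Hc].
  assert (Hmem : forall i u, code_mem (pair i u) c <-> R i u).
  { intros i u; rewrite Hc, HXa; split.
    - intros (_ & i' & _ & u' & _ & Heq & H).
      apply pair_inj in Heq; destruct Heq as [-> ->]; exact H.
    - intros H; destruct (Hrange i u H) as (Hi & Hu & _).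
      split; [apply pair_mono; assumption|].
      exists i; split; [apply le_pair_l|].
      exists u; split; [apply le_pair_r|auto]. }
  exists c, l; split; [|split; [|split; [|split]]].
  - split; [|split].
    + intros a Ha; apply Hc in Ha; destruct Ha as [_ Ha]; apply HXa in Ha.
      destruct Ha as (i & _ & u & _ & -> & _); exists i, u; reflexivity.
    + intros i u v; rewrite !Hmem; apply Hfun.
    + intros i; split.
      * intros Hi; destruct (Htot i Hi) as [u Hu]; exists u; apply Hmem, Hu.
      * intros [u Hu]; apply Hmem, Hrange in Hu; tauto.
  - apply Hmem, Hx.
  - apply Hmem, Hy.
  - intros i u H; apply Hmem in H; apply (Hrange i u H).
  - intros i u v Hi; rewrite !Hmem; apply Hadj, Hi.
Qed.

Lemma path_refl (V E : N -> Prop) (x : N) : V x -> path_between V E x x.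
Proof.
  intros HV; apply (path_of_relation V E (fun i u => i = 0 /\ u = x) x x 0 x).
  - bounded.
  - intros i Hi; apply (lt_succ M Hb) in Hi; destruct Hi as [Hi|Hi]; eauto.
    destruct (not_lt_zero M Hb _ Hi).
  - intros i u v [_ ->] [_ ->]; reflexivity.
  - intros i u [-> ->]; auto using le_refl.
  - auto.
  - auto.
  - intros i u v Hi; destruct (not_lt_zero M Hb _ Hi).
Qed.

Lemma path_edge (V E : N -> Prop) (x y : N) :
  V x -> V y -> adjacent E x y -> path_between V E x y.
Proof.
  intros Hx Hy Hxy.
  assert (H01 : (zero : N) <> one)
    by (rewrite <- (zero_add 1); intros H;
        exact (succ_neq_zero M Hb 0 (eq_sym H))).
  apply (path_of_relation V E
    (fun i u => (i = 0 /\ u = x) \/ (i = 1 /\ u = y)) x y 1 (x + y)).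
  - bounded.
  - intros i Hi; apply (lt_succ M Hb) in Hi; destruct Hi as [Hi| ->]; eauto.
    rewrite <- (zero_add 1) in Hi.
    apply (lt_succ M Hb) in Hi; destruct Hi as [Hi| ->]; eauto.
    destruct (not_lt_zero M Hb _ Hi).
  - intros i u v [[-> ->]|[-> ->]] [[H ->]|[H ->]]; congruence.
  - intros i u [[-> ->]|[-> ->]]; (split; [|split; [|assumption]]).
    + apply zero_le.
    + apply le_add.
    + apply le_refl.
    + rewrite (add_comm x); apply le_add.
  - auto.
  - auto.
  - intros i u v Hi [[-> ->]|[-> ->]]; [|destruct (lt_irrefl _ Hi)].
    rewrite zero_add; intros [[H ->]|[_ ->]]; congruence.
Qed.

Lemma adjacent_sym (E : N -> Prop) (u v : N) : adjacent E u v -> adjacent E v u.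
Proof. unfold adjacent; tauto. Qed.

(* The path from [x] to [y] is run through backwards, then the one to [z]. *)
Lemma path_join (V E : N -> Prop) (x y z : N) :
  path_between V E x y -> path_between V E x z -> path_between V E y z.
Proof.
  intros (p & l & (_ & Hfun & Hdom) & Hp0 & Hpl & HpV & Hpadj)
    (q & l' & (_ & Hfun' & Hdom') & Hq0 & Hql & HqV & Hqadj).
  (* Position i takes entry l - i of [p] as long as i <= l, and entry i - l of [q] from l on; sums
     replace the differences. *)
  apply (path_of_relation V E (fun i u =>
    (exists j, j < l + 1 /\ (i + j = l /\ code_mem (pair j u) p)) \/
    (exists j, j < l' + 1 /\ (i = l + j /\ code_mem (pair j u) q)))
    y z (l + l') (p + q)).
  - bounded.
  - intros i Hi; destruct (le_or_lt i l) as [H|H].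
    + apply le_iff in H; destruct H as [j ->].
      assert (Hj : j <= i + j) by (rewrite (add_comm i); apply le_add).
      destruct (proj1 (Hdom j) Hj) as [u Hu].
      exists u; left; exists j; auto.
    + apply lt_iff in H; destruct H as [j ->].
      assert (Hj : j + 1 <= l').
      { apply le_iff in Hi; destruct Hi as [d Hd]; apply le_iff; exists d.
        apply (add_cancel _ _ l); rewrite Hd; ring. }
      destruct (proj1 (Hdom' (j + 1)) Hj) as [u Hu].
      exists u; right; exists (j + 1); repeat split; auto; ring.
  (* The two pieces overlap at position l only, where both give [x]. *)
  - assert (Hmeet : forall i j j' u v, i + j = l -> i = l + j' ->
      code_mem (pair j u) p -> code_mem (pair j' v) q -> u = v).
    { intros i j j' u v H -> Hu Hv.
      assert (H0 : 0 = j' + j).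
      { apply (add_cancel _ _ l); transitivity l; [ring|].
        rewrite <- H at 1; ring. }
      apply zero_sum in H0; destruct H0 as [-> ->].
      rewrite (Hfun _ _ _ Hu Hp0); symmetry; exact (Hfun' _ _ _ Hv Hq0). }
    intros i u v [(j & _ & H & Hu)|(j & _ & H & Hu)]
      [(j' & _ & H' & Hv)|(j' & _ & H' & Hv)]; eauto.
    + assert (j = j') as <- by (apply (add_cancel _ _ i); congruence).
      exact (Hfun _ _ _ Hu Hv).
    + symmetry; eauto.
    + assert (j = j') as <- by (apply (add_cancel _ _ l); congruence).
      exact (Hfun' _ _ _ Hu Hv).
  - intros i u [(j & _ & <- & Hu)|(j & Hj & -> & Hu)].
    + split; [|split; [|exact (HpV _ _ Hu)]].
      * apply le_iff; exists (j + l'); ring.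
      * apply code_mem_value_lt in Hu.
        apply lt_iff in Hu; destruct Hu as [d ->].
        apply le_iff; exists (d + 1 + q); ring.
    + split; [|split; [|exact (HqV _ _ Hu)]].
      * apply le_iff in Hj; destruct Hj as [d ->].
        apply le_iff; exists d; ring.
      * apply code_mem_value_lt in Hu.
        apply lt_iff in Hu; destruct Hu as [d ->].
        apply le_iff; exists (d + 1 + p); ring.
  - left; exists l; split; [apply le_refl|]; split; [ring|exact Hpl].
  - right; exists l'; split; [apply le_refl|]; auto.
  - assert (Hback : forall i j j' u v, i + j = l -> i + 1 + j' = l ->
      code_mem (pair j u) p -> code_mem (pair j' v) p -> adjacent E u v).
    { intros i j j' u v H H' Hu Hv; apply adjacent_sym.
      assert (j = j' + 1) as ->.
      { apply (add_cancel _ _ i); rewrite H, <- H'; ring. }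
      apply (Hpadj j'); auto.
      apply lt_iff; exists i; rewrite <- H; ring. }
    assert (Hforth : forall i j j' u v, i < l + l' -> i = l + j ->
      i + 1 = l + j' ->
      code_mem (pair j u) q -> code_mem (pair j' v) q -> adjacent E u v).
    { intros i j j' u v Hi -> H Hu Hv.
      assert (j' = j + 1) as ->.
      { apply (add_cancel _ _ l); rewrite <- H; ring. }
      apply (Hqadj j); auto.
      apply lt_iff in Hi; destruct Hi as [d Hd]; apply lt_iff; exists d.
      apply (add_cancel _ _ l); rewrite Hd; ring. }
    intros i u v Hi [(j & _ & H & Hu)|(j & _ & H & Hu)]
      [(j' & _ & H' & Hv)|(j' & _ & H' & Hv)]; eauto.
    (* At the junction, [x] is entry 0 of both sequences: a step out of position l is read in [q], a
       step into it in [p]. *)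
    + destruct (zero_or_succ j) as [->|[j0 ->]].
      * assert (u = x) as -> by exact (Hfun _ _ _ Hu Hp0).
        apply (Hforth i 0 j'); auto; rewrite <- H; ring.
      * assert (H0 : 0 = j0 + j').
        { apply (add_cancel _ _ (i + 1)); transitivity (i + 1); [ring|].
          rewrite H' at 1; rewrite <- H; ring. }
        apply zero_sum in H0; destruct H0 as [-> ->].
        assert (v = x) as -> by exact (Hfun' _ _ _ Hv Hq0).
        apply (Hback i (0 + 1) 0); auto; rewrite <- H; ring.
    (* A step from the second piece back to the first would need i >= l and i + 1 <= l. *)
    + exfalso; subst i; apply (succ_neq_zero M Hb (j + j')).
      apply (add_cancel _ _ l); transitivity (l + j + 1 + j'); [ring|].
      rewrite H'; ring.
Qed.

(** Joining a path with the constant path at [x] reverses it, after which [path_join] applies at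
    [y]. *)
Lemma path_trans (V E : N -> Prop) (x y z : N) :
  V x -> path_between V E x y -> path_between V E y z -> path_between V E x z.
Proof.
  intros Hx Hxy; apply path_join.
  exact (path_join _ _ _ _ _ Hxy (path_refl V E x Hx)).
Qed.

Lemma path_end_vertex (V E : N -> Prop) (x y : N) :
  path_between V E x y -> V y.
Proof. intros (p & l & _ & _ & Hy & HV & _); exact (HV _ _ Hy). Qed.

(** * From weak partitions to components *)

Definition first_vertex (V : N -> Prop) (n x : N) : Prop :=
  (V x /\ n <= x) /\ forall z, z < x -> ~ (V z /\ n <= z).

Lemma first_vertex_exists (V : N -> Prop) (n : N) :
  is_set M V -> (forall m, exists x, m < x /\ V x) ->
  exists x, first_vertex V n x.
Proof.
  intros HV Hinf; apply (least_element (fun x => V x /\ n <= x)); [bounded|].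
  destruct (Hinf n) as (x & Hx & HVx); exists x; split; [exact HVx|].
  exact (lt_trans _ _ _ Hx (le_refl x)).
Qed.

Lemma first_vertex_unique (V : N -> Prop) (n x y : N) :
  first_vertex V n x -> first_vertex V n y -> x = y.
Proof.
  intros [Hx Hx'] [Hy Hy'].
  destruct (lt_total x y) as [H|[H|H]]; [|exact H|].
  - destruct (Hy' x H Hx).
  - destruct (Hx' y H Hy).
Qed.

Lemma first_vertex_self (V : N -> Prop) (x : N) : V x -> first_vertex V x x.
Proof.
  intros Hx; split; [split; [exact Hx|apply le_refl]|].
  intros z Hz [_ H]; exact (lt_irrefl _ (le_lt_trans _ _ _ H Hz)).
Qed.

Definition connects (V E : N -> Prop) (i j : N) : Prop :=
  exists x y, first_vertex V i x /\ first_vertex V j y /\ path_between V E x y.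

(** A stage carries the indices together with the path that justifies them, so recognizing it is a
    bounded matter. The end points are entries of [p], hence below it. *)
Definition connection_code (V E : N -> Prop) (s i j : N) : Prop :=
  exists p, p < s + 1 /\ exists l, l < s + 1 /\
    (s = pair (pair i j) (pair p l) /\
     exists x, x < p /\ exists y, y < p /\
       (first_vertex V i x /\ first_vertex V j y /\ path_code V E p l x y)).

Lemma connects_iff_code (V E : N -> Prop) (i j : N) :
  connects V E i j <-> exists s, connection_code V E s i j.
Proof.
  split.
  - intros (x & y & Hx & Hy & p & l & Hp).
    exists (pair (pair i j) (pair p l)), p.
    assert (Hpl : pair p l <= pair (pair i j) (pair p l)) by apply le_pair_r.
    split; [exact (le_lt_trans _ _ _ (le_pair_l p l) Hpl)|].
    exists l; split; [exact (le_lt_trans _ _ _ (le_pair_r p l) Hpl)|].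
    split; [reflexivity|].
    destruct Hp as (Hfin & H0 & Hl & HVE).
    exists x; split; [exact (code_mem_value_lt _ _ _ H0)|].
    exists y; split; [exact (code_mem_value_lt _ _ _ Hl)|].
    unfold path_code; tauto.
  - intros (s & p & _ & l & _ & _ & x & _ & y & _ & Hx & Hy & Hp).
    exists x, y; split; [exact Hx|split; [exact Hy|exists p, l; exact Hp]].
Qed.

Lemma connection_code_inj (V E : N -> Prop) (s i j i' j' : N) :
  connection_code V E s i j -> connection_code V E s i' j' -> i = i' /\ j = j'.
Proof.
  intros (p & _ & l & _ & H & _) (p' & _ & l' & _ & H' & _).
  rewrite H in H'; apply pair_inj in H'; apply pair_inj, H'.
Qed.

(* Stages that code no path enumerate [0] into the block of index [0]. *)
Lemma connects_enumeration (V E : N -> Prop) :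
  countable_graph M V E ->
  exists D, enumerated_sequence M D /\
    forall i j, enum_mem D i j <-> connects V E i j.
Proof.
  intros HG.
  assert (HV : is_set M V) by apply HG; assert (HE : is_set M E) by apply HG.
  destruct (bounded_comprehension (fun a =>
    exists s, s < a + 1 /\ exists i, i < a + 1 /\ exists j, j < a + 1 /\
      (a = pair s (pair i j) /\
       (connection_code V E s i j \/
        ((~ exists i', i' < s + 1 /\ exists j', j' < s + 1 /\
             connection_code V E s i' j') /\ i = 0 /\ j = 0)))))
    as (D & HD & HDa); [unfold connection_code; bounded|].
  assert (HDs : forall s i j, D (pair s (pair i j)) <->
    connection_code V E s i j \/
    ((~ exists i' j', connection_code V E s i' j') /\ i = 0 /\ j = 0)).
  { intros s i j.
    assert (Hno : (exists i' j', connection_code V E s i' j') <->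
      exists i', i' < s + 1 /\ exists j', j' < s + 1 /\
        connection_code V E s i' j').
    { split; [|intros (i' & _ & j' & _ & H); exists i', j'; exact H].
      intros (i' & j' & H); exists i'.
      assert (Hs : pair i' j' <= s)
        by (destruct H as (p & _ & l & _ & -> & _); apply le_pair_l).
      split; [exact (le_lt_trans _ _ _ (le_pair_l i' j') Hs)|].
      exists j'; split; [exact (le_lt_trans _ _ _ (le_pair_r i' j') Hs)|].
      exact H. }
    rewrite HDa, Hno; split.
    - intros (s' & _ & i' & _ & j' & _ & Heq & H).
      apply pair_inj in Heq; destruct Heq as [<- Heq].
      apply pair_inj in Heq; destruct Heq as [<- <-]; exact H.
    - intros H; exists s; split; [apply le_pair_l|].
      assert (Hij : pair i j <= pair s (pair i j)) by apply le_pair_r.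
      exists i; split; [exact (le_lt_trans _ _ _ (le_pair_l i j) Hij)|].
      exists j; split; [exact (le_lt_trans _ _ _ (le_pair_r i j) Hij)|].
      auto. }
  assert (Hpairs : forall a, D a -> exists s i j, a = pair s (pair i j)).
  { intros a Ha; apply HDa in Ha.
    destruct Ha as (s & _ & i & _ & j & _ & H & _); exists s, i, j; exact H. }
  exists D; split; [split; [exact HD|exact Hpairs|]|].
  - intros s.
    assert (Huniq : forall i j, D (pair s (pair i j)) ->
      (forall i' j', D (pair s (pair i' j')) -> i = i' /\ j = j') ->
      exists! v, D (pair s v)).
    { intros i j Hij H; exists (pair i j); split; [exact Hij|].
      intros v Hv; destruct (Hpairs _ Hv) as (s' & i' & j' & Heq).
      apply pair_inj in Heq; destruct Heq as [<- ->].
      destruct (H i' j' Hv) as [-> ->]; reflexivity. }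
    destruct (classic (exists i j, connection_code V E s i j))
      as [(i & j & H)|H].
    + apply (Huniq i j); [apply HDs; auto|].
      intros i' j' H'; apply HDs in H'; destruct H' as [H'|[H' _]].
      * exact (connection_code_inj _ _ _ _ _ _ _ H H').
      * destruct H'; eauto.
    + apply (Huniq 0 0); [apply HDs; auto|].
      intros i' j' H'; apply HDs in H'; destruct H' as [H'|(_ & -> & ->)]; auto.
      destruct H; eauto.
  - intros i j; rewrite connects_iff_code; split.
    (* The default element is sound, because 0 is connected with itself through the constant path at
       its first vertex. *)
    + intros [s Hs]; apply HDs in Hs; destruct Hs as [Hs|(_ & -> & ->)]; eauto.
      apply connects_iff_code.
      destruct (first_vertex_exists V 0 HV (vertices_infinite M V E HG))
        as [x Hx].
      exists x, x; split; [exact Hx|split; [exact Hx|]].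
      apply path_refl, Hx.
    + intros [s Hs]; exists s; apply HDs; auto.
Qed.

Lemma component_of_block :
  every_weak_partition_has_existing_block M -> every_graph_has_component M.
Proof.
  intros Hpart V E HG.
  assert (HV : is_set M V) by apply HG.
  assert (Hfirst : forall n, exists x, first_vertex V n x).
  { intros n; exact (first_vertex_exists V n HV (vertices_infinite M V E HG)). }
  assert (Hrefl : forall i, connects V E i i).
  { intros i; destruct (Hfirst i) as [x Hx].
    exists x, x; split; [exact Hx|split; [exact Hx|]].
    apply path_refl, Hx. }
  (* Together with reflexivity this makes [connects] an equivalence relation, whose classes are the
     blocks. *)
  assert (Heucl : forall i j k,
    connects V E i j -> connects V E i k -> connects V E j k).
  { intros i j k (x & y & Hx & Hy & Hxy) (x' & z & Hx' & Hz & Hxz).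
    rewrite <- (first_vertex_unique V i x x' Hx Hx') in Hxz.
    exists y, z; split; [exact Hy|split; [exact Hz|]].
    exact (path_join V E x y z Hxy Hxz). }
  destruct (connects_enumeration V E HG) as (D & HD & HDij).
  destruct (Hpart D) as (i & X & HX & HXj).
  { split; [exact HD| |].
    - intros n; exists n; apply HDij, Hrefl.
    - intros i j; destruct (classic (connects V E i j)) as [Hij|Hij].
      + left; intros n; rewrite !HDij; split; [eauto|].
        apply Heucl, (Heucl i); auto.
      + right; intros n; rewrite !HDij; intros [Hin Hjn].
        apply Hij, (Heucl n); [apply (Heucl i)|apply (Heucl j)]; auto. }
  destruct (Hfirst i) as [x0 Hx0].
  assert (HXV : forall x, V x -> (X x <-> path_between V E x0 x)).
  { intros x Hx; rewrite HXj, HDij; split.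
    - intros (x0' & x' & Hx0' & Hx' & H).
      rewrite (first_vertex_unique V i x0 x0' Hx0 Hx0').
      rewrite (first_vertex_unique V x x x' (first_vertex_self V x Hx) Hx').
      exact H.
    - intros H; exists x0, x; auto using first_vertex_self. }
  (* [X] may also contain numbers that are not vertices but whose first vertex lies in the
     component. *)
  destruct (bounded_comprehension (fun x => V x /\ X x)) as (C & HC & HCx);
    [bounded|].
  assert (HCpath : forall x, C x <-> path_between V E x0 x).
  { intros x; rewrite HCx; split; [intros [HVx H]; apply HXV; assumption|].
    intros H; pose proof (path_end_vertex V E _ _ H) as HVx.
    split; [exact HVx|apply HXV; assumption]. }
  exists C; split; [exact HC| | | |].
  - exists x0; apply HCpath, path_refl, Hx0.
  - intros x Hx; apply HCx, Hx.
  - intros x y Hx Hy; apply (path_join V E x0); apply HCpath; assumption.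
  - intros x y Hx Hxy; apply HCpath, (path_trans V E x0 x y);
      [apply Hx0|apply HCpath, Hx|exact Hxy].
Qed.

(** * From components to weak partitions *)

Definition linked (u v : N) : Prop :=
  exists s i n s' i' n',
    u = pair s (pair i n) /\ v = pair s' (pair i' n') /\ (i = i' \/ n = n').

Lemma linked_sym (u v : N) : linked u v -> linked v u.
Proof.
  intros (s & i & n & s' & i' & n' & Hu & Hv & H).
  exists s', i', n', s, i, n; repeat split; auto; intuition.
Qed.

Lemma triple_bounds (s i n : N) :
  s <= pair s (pair i n) /\ i <= pair s (pair i n) /\ n <= pair s (pair i n).
Proof.
  repeat split; [apply le_pair_l| |];
    (eapply le_lt_trans; [|apply le_pair_r]); [apply le_pair_l|apply le_pair_r].
Qed.

Lemma linked_iff_bounded (u v : N) : linked u v <->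
  exists s, s < u + 1 /\ exists i, i < u + 1 /\ exists n, n < u + 1 /\
  exists s', s' < v + 1 /\ exists i', i' < v + 1 /\ exists n', n' < v + 1 /\
    (u = pair s (pair i n) /\ v = pair s' (pair i' n') /\ (i = i' \/ n = n')).
Proof.
  split; [|intros (s & _ & i & _ & n & _ & s' & _ & i' & _ & n' & _ & H);
           exists s, i, n, s', i', n'; exact H].
  intros (s & i & n & s' & i' & n' & -> & -> & H).
  destruct (triple_bounds s i n) as (? & ? & ?).
  destruct (triple_bounds s' i' n') as (? & ? & ?).
  exists s; split; [assumption|]; exists i; split; [assumption|].
  exists n; split; [assumption|]; exists s'; split; [assumption|].
  exists i'; split; [assumption|]; exists n'; split; [assumption|]; auto.
Qed.

(** A vertex is linked to itself but edges join distinct vertices, hence the premise [u <> v]. *)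
Lemma enumeration_graph (D : N -> Prop) :
  enumerated_sequence M D ->
  exists E, countable_graph M D E /\
    forall u v, D u -> D v -> u <> v -> (adjacent E u v <-> linked u v).
Proof.
  intros HD.
  assert (HDset : is_set M D) by apply HD.
  destruct (bounded_comprehension (fun a =>
    exists u, u < a + 1 /\ exists v, v < a + 1 /\
      (a = pair u v /\ u < v /\ D u /\ D v /\
       exists s, s < u + 1 /\ exists i, i < u + 1 /\ exists n, n < u + 1 /\
       exists s', s' < v + 1 /\ exists i', i' < v + 1 /\ exists n', n' < v + 1 /\
         (u = pair s (pair i n) /\ v = pair s' (pair i' n') /\
          (i = i' \/ n = n')))))
    as (E & HE & HEa); [bounded|].
  assert (HEuv : forall u v, E (pair u v) <-> u < v /\ D u /\ D v /\ linked u v).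
  { intros u v; rewrite HEa, linked_iff_bounded; split.
    - intros (u' & _ & v' & _ & Heq & H).
      apply pair_inj in Heq; destruct Heq as [-> ->]; exact H.
    - intros H; exists u; split; [apply le_pair_l|].
      exists v; split; [apply le_pair_r|auto]. }
  (* There is a vertex for each stage, and a pair is at least its first component. *)
  assert (Hcofinal : forall m, exists x, m < x /\ D x).
  { intros m; destruct (enum_function M D HD (m + 1)) as (v & Hv & _).
    exists (pair (m + 1) v); split; [|exact Hv].
    exact (lt_le_trans _ _ _ (le_refl m) (le_pair_l _ _)). }
  exists E; split; [split|].
  - exact HDset.
  - destruct (Hcofinal 0) as (x & _ & Hx); eauto.
  - exact Hcofinal.
  - exact HE.
  - intros a Ha; pose proof Ha as Ha'; apply HEa in Ha'.
    destruct Ha' as (u & _ & v & _ & Heq & Huv & Hu & Hv & _).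
    exists u, v; auto.
  - intros u v Hu Hv Hne; unfold adjacent; rewrite !HEuv; split.
    + intros [(_ & _ & _ & _ & H)|(_ & _ & _ & _ & H)];
        [exact H|apply linked_sym, H].
    + intros H; destruct (lt_total u v) as [Huv|[Huv|Huv]]; [left|tauto|right];
        repeat (split; [assumption|]); auto using linked_sym.
Qed.

Lemma path_same_block (D E : N -> Prop) (s i n s' i' n' : N) :
  weak_partition M D ->
  (forall u v, D u -> D v -> adjacent E u v -> linked u v) ->
  D (pair s (pair i n)) ->
  path_between D E (pair s (pair i n)) (pair s' (pair i' n')) ->
  enum_mem D i n'.
Proof.
  intros HD HE H0 (p & l & (_ & Hfun & Hdom) & Hp0 & Hpl & HpD & Hpadj).
  assert (HDset : is_set M D) by apply HD.
  (* Induction along the path. The stage [r] that puts the number of the k-th vertex into the block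
     of [i] has no a priori bound, so it takes the Sigma^0_1 quantifier; all else is bounded. *)
  assert (Hind : forall k, exists r, k <= l -> exists u, u < p /\
    (code_mem (pair k u) p /\
     exists t, t < u + 1 /\ exists j, j < u + 1 /\ exists m, m < u + 1 /\
       (u = pair t (pair j m) /\ D (pair r (pair i m))))).
  { apply Sigma_ind; [bounded| |].
    - exists s; intros _; exists (pair s (pair i n)).
      split; [exact (code_mem_value_lt _ _ _ Hp0)|split; [exact Hp0|]].
      destruct (triple_bounds s i n) as (? & ? & ?).
      exists s; split; [assumption|]; exists i; split; [assumption|].
      exists n; split; [assumption|]; auto.
    - intros k r IH.
      destruct (classic (k + 1 <= l)) as [Hk|Hk]; [|exists 0; tauto].
      assert (Hkl : k < l).
      { apply le_iff in Hk; destruct Hk as [d ->].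
        apply lt_iff; exists d; ring. }
      destruct IH as (u & _ & Hu & t & _ & j & _ & m & _ & -> & Hm);
        [exact (lt_trans _ _ _ Hkl (le_refl l))|].
      destruct (proj1 (Hdom (k + 1)) Hk) as [v Hv].
      pose proof (HpD _ _ Hu) as HDu; pose proof (HpD _ _ Hv) as HDv.
      destruct (HE _ _ HDu HDv (Hpadj k _ _ Hkl Hu Hv))
        as (t1 & j1 & m1 & t' & j' & m' & Heq & -> & Hjm).
      apply pair_inj in Heq; destruct Heq as [<- Heq].
      apply pair_inj in Heq; destruct Heq as [<- <-].
      assert (Hm' : enum_mem D i m').
      (* If the index is shared, the blocks of [i] and [j] meet in [m] and are therefore equal; if
         the number is shared, the old stage still works. *)
      { destruct Hjm as [<-|<-]; [|exists r; exact Hm].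
        destruct (weak_partition_blocks M D HD i j) as [Hij|Hij].
        - apply Hij; exists t'; exact HDv.
        - destruct (Hij m); split; [exists r; exact Hm|exists t; exact HDu]. }
      destruct Hm' as [r' Hr']; exists r'; intros _.
      exists (pair t' (pair j' m')).
      split; [exact (code_mem_value_lt _ _ _ Hv)|split; [exact Hv|]].
      destruct (triple_bounds t' j' m') as (? & ? & ?).
      exists t'; split; [assumption|]; exists j'; split; [assumption|].
      exists m'; split; [assumption|]; auto. }
  destruct (Hind l) as [r Hr].
  destruct (Hr (le_refl l)) as (u & _ & Hu & t & _ & j & _ & m & _ & Heq & Hm).
  rewrite (Hfun _ _ _ Hu Hpl) in Heq.
  apply pair_inj in Heq; destruct Heq as [_ Heq].
  apply pair_inj in Heq; destruct Heq as [_ ->]; exists r; exact Hm.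
Qed.

Lemma block_of_component :
  every_graph_has_component M -> every_weak_partition_has_existing_block M.
Proof.
  intros Hcomp D HD.
  assert (HDset : is_set M D) by apply HD.
  destruct (enumeration_graph D (weak_partition_enum M D HD))
    as (E & HG & Hadj).
  destruct (Hcomp D E HG) as [C HC].
  assert (HCset : is_set M C) by apply HC.
  assert (Hlinked : forall u v, C u -> D v -> linked u v -> C v).
  { intros u v Hu Hv Huv.
    destruct (classic (u = v)) as [<-|Hne]; [exact Hu|].
    pose proof (component_vertices M D E C HC u Hu) as HDu.
    apply (component_closed M D E C HC u); [exact Hu|].
    apply path_edge; [exact HDu|exact Hv|]; apply Hadj; assumption. }
  assert (Hadj' : forall u v, D u -> D v -> adjacent E u v -> linked u v).
  { intros u v Hu Hv Huv; apply Hadj; auto; intros <-.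
    destruct Huv as [[H _]|[H _]]; exact (lt_irrefl _ H). }
  destruct (component_nonempty M D E C HC) as [a Ha].
  pose proof (component_vertices M D E C HC a Ha) as HDa.
  destruct (enum_pairs M D (weak_partition_enum M D HD) a HDa)
    as (s & i & n & ->).
  assert (HCi : forall t m, D (pair t (pair i m)) -> C (pair t (pair i m))).
  { intros t m Ht; apply (Hlinked (pair s (pair i n))); auto.
    exists s, i, n, t, i, m; auto. }
  assert (HCmem : forall t j m, C (pair t (pair j m)) -> enum_mem D i m).
  { intros t j m Ht.
    apply (path_same_block D E s i n t j m); auto.
    exact (component_connected M D E C HC _ _ Ha Ht). }
  (* For a fixed [m], the vertices that mention [m] are pairwise linked, so one of them is in [C]
     exactly when all are. *)
  exists i; apply (Delta_comprehension (fun m => enum_mem D i m)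
    (fun b m => C b /\ exists t, t < b + 1 /\ exists j, j < b + 1 /\
       b = pair t (pair j m))
    (fun b m => (D b /\ exists t, t < b + 1 /\ exists j, j < b + 1 /\
       b = pair t (pair j m)) -> C b)); [bounded|bounded| |].
  - intros m; split.
    + intros [t Ht]; exists (pair t (pair i m)); split; [apply HCi, Ht|].
      destruct (triple_bounds t i m) as (? & ? & _); eauto 6.
    + intros (b & Hb' & t & _ & j & _ & ->); eapply HCmem, Hb'.
  - intros m; split.
    + intros [r Hr] b (Hb' & t & _ & j & _ & ->).
      apply (Hlinked (pair r (pair i m))); [apply HCi, Hr|exact Hb'|].
      exists r, i, m, t, j, m; auto.
    (* Since the blocks cover all numbers, some vertex mentions [m] and the universal form is not
       vacuous. *)
    + intros H; destruct (weak_partition_cover M D HD m) as (j & t & Ht).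
      apply (HCmem t j); apply H; split; [exact Ht|].
      destruct (triple_bounds t j m) as (? & ? & _); eauto 6.
Qed.

End ModelOfRCA0.

Theorem theorem5p2 :
  forall M : L2_structure, RCA0 M ->
    (every_graph_has_component M <-> every_weak_partition_has_existing_block M).
Proof.
  intros M HM; split.
  - apply block_of_component, HM.
  - apply component_of_block, HM.
Qed.
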